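(* Let $N$ be a positive integer. Suppose that for every $\epsilon>0$ there exists a constant $C_\epsilon$ such that $f(\mathbf{a},\epsilon)<C_\epsilon$ for every ABC-solution $\mathbf{a}=(a,b,c)$ with $N\mid abc$. Then for every $\epsilon>0$ there exists a constant $C'_\epsilon$ such that $f(\mathbf{a},\epsilon)<C'_\epsilon$ for every ABC-solution $\mathbf{a}$ (i.e. the full ABC conjecture holds).
   Context: An ABC-solution is a triple $\mathbf{a}=(a,b,c)$ of distinct integers with $\gcd(a,b,c)=1$, $a+b+c=0$, and $a<0$, $b<0$ (so $c>0$). For a positive integer $n$, $\mathrm{rad}(n)$ denotes the product of the distinct primes dividing $n$, and $\mathrm{rad}(abc)$ means $\mathrm{rad}(|abc|)$. For $\epsilon>0$ and an ABC-solution $\mathbf{a}=(a,b,c)$, set $f(\mathbf{a},\epsilon)=\log c-(1+\epsilon)\log\mathrm{rad}(abc)$. *)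

(* Defs.v *)
From HB Require Import structures.
From mathcomp Require Import all_boot all_order all_algebra.
From mathcomp Require Import reals exp.

Set Implicit Arguments.
Unset Strict Implicit.
Unset Printing Implicit Defensive.

Import Order.TTheory GRing.Theory Num.Theory.
Local Open Scope ring_scope.

Definition ABC_solution (a b c : int) : Prop :=
  [/\ [/\ a <> b, b <> c & a <> c],
      gcdz (gcdz a b) c = 1,
      a + b + c = 0 &
      a < 0 /\ b < 0].

Definition radn (n : nat) : nat := (\prod_(p <- primes n) p)%N.

Definition ABC_f (R : realType) (a b c : int) (eps : R) : R :=
  ln (c%:~R) - (1 + eps) * ln ((radn `|(a * b * c)%R|%N)%:R).

(* Main.v *)
(** Let [x = -a], [y = -b] and [c = x + y] with [y < x], put [d = x - y], and
    let [C, D] be [c, d] divided by their gcd, which is 1 or 2.  For a suitable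
    even [n] depending only on [N], Euler's theorem gives
    [N | D^n (C^n - D^n) C^n], so the triple [(- D^n, D^n - C^n, C^n)] falls
    under the hypothesis.  As [c^2 - d^2 = 4 x y] divides [c^n - d^n], its
    radical is at most [rad (x y c) * n * c^(n - 1)].  The hypothesis at [delta]
    thus bounds [(1 - (n - 1) delta) ln c - (1 + delta) ln rad (abc)], and
    [delta] is chosen so that the ratio of the two coefficients is [1 + eps]. *)

Require Import Defs.
From HB Require Import structures.
From mathcomp Require Import all_boot all_order all_algebra.
From mathcomp Require Import reals exp.
From mathcomp Require Import cyclic zify ring lra.
Import Order.TTheory GRing.Theory Num.Theory.

Section Radical.
Local Open Scope nat_scope.

Lemma radn_gt0 n : 0 < radn n.
Proof.
rewrite /radn big_seq; apply: prodn_cond_gt0 => p.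
by rewrite mem_primes => /and3P[/prime_gt0].
Qed.

Lemma coprime_prime_prod p (s : seq nat) :
  prime p -> all prime s -> p \notin s -> coprime p (\prod_(q <- s) q).
Proof.
move=> pp; elim: s => [|q s IHs] /=; first by rewrite big_nil coprimen1.
case/andP=> pq ps; rewrite inE negb_or big_cons coprimeMr => /andP[npq nps].
by rewrite IHs // andbT prime_coprime // dvdn_prime2.
Qed.

Lemma dvdn_prime_prod (s : seq nat) m :
  uniq s -> all prime s -> (forall p, p \in s -> p %| m) ->
  \prod_(q <- s) q %| m.
Proof.
elim: s => [|q s IHs] /=; first by rewrite big_nil dvd1n.
case/andP=> nqs us /andP[pq ps] sm; rewrite big_cons Gauss_dvd.
  by rewrite sm ?mem_head //= IHs // => p ps'; rewrite sm // inE ps' orbT.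
exact: coprime_prime_prod.
Qed.

(** Serves to bound a radical from above: it suffices to exhibit a positive [m] divisible by every
    prime factor of [n]. *)
Lemma radn_dvd n m :
  (forall p, prime p -> p %| n -> p %| m) -> radn n %| m.
Proof.
move=> nm; apply: dvdn_prime_prod; first exact: primes_uniq.
  by apply/allP=> p; rewrite mem_primes => /and3P[].
by move=> p; rewrite mem_primes => /and3P[pp _ /(nm p pp)].
Qed.

Lemma dvdn_radn p n : 0 < n -> prime p -> p %| n -> p %| radn n.
Proof.
move=> n0 pp pn; rewrite /radn (big_rem p) ?dvdn_mulr //=.
by rewrite mem_primes pp n0.
Qed.

End Radical.

Section Descent.
Local Open Scope nat_scope.

Lemma totient_dvd m n : coprime m n -> totient m %| totient (m * n).
Proof. by move=> /totient_coprime ->; apply: dvdn_mulr. Qed.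

(** Checked one prime power [p ^ v] of [N] at a time. If [p] divides [X] or [Y], then [v <= n]
    suffices. Otherwise [totient (p ^ v)] divides [totient N], hence [n], and by Euler both [n]-th
    powers are 1 modulo [p ^ v]. *)
Lemma dvdn_expM_sub_exp N X Y (n := (N * totient N).*2) : 0 < N ->
  N %| Y ^ n * (X ^ n - Y ^ n) * X ^ n.
Proof.
move=> N0; apply/(dvdn_partP _ N0) => p; rewrite mem_primes => /and3P[pp _ pN].
have tN : 0 < totient N by rewrite totient_gt0.
have Nn : logn p N <= n.
  apply: leq_trans (ltnW (ltn_logl p N0)) _; rewrite /n; nia.
rewrite p_part.
have [pX|npX] := boolP (p %| X).
  by rewrite dvdn_mull // (dvdn_trans (dvdn_exp2l p Nn)) // dvdn_exp2r.
have [pY|npY] := boolP (p %| Y).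
  by rewrite -mulnA dvdn_mulr // (dvdn_trans (dvdn_exp2l p Nn)) // dvdn_exp2r.
apply/dvdn_mulr/dvdn_mull.
have [k ->] : exists k, n = totient (p ^ logn p N) * k.
  have /dvdnP[j jE] : totient (p ^ logn p N) %| totient N.
    rewrite -p_part -{2}(partnC p N0); apply: totient_dvd; exact: coprime_partC.
  by exists (j * N).*2; rewrite /n jE -!muln2; ring.
have E1 Z : ~~ (p %| Z) ->
    Z ^ (totient (p ^ logn p N) * k) = 1 %[mod p ^ logn p N].
  move=> npZ; rewrite expnM -modnXm Euler_exp_totient ?modnXm ?exp1n //.
  by rewrite coprime_sym coprimeXl // prime_coprime.
(* Subtraction is truncated: when [Y ^ n] is the larger power, the difference is 0. *)
have [le|/ltnW] := leqP (Y ^ (totient (p ^ logn p N) * k))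
                        (X ^ (totient (p ^ logn p N) * k)).
  by rewrite -eqn_mod_dvd // !E1.
by rewrite -subn_eq0 => /eqP ->; rewrite dvdn0.
Qed.

(** Comparing 2-adic valuations, equality would make [n] divide 1. This keeps the first two entries
    of the new triple distinct. *)
Lemma expn_neq_double_expn n C D : 1 < n -> 0 < D -> C ^ n <> 2 * D ^ n.
Proof.
move=> n1 D0 E; have := congr1 (logn 2) E.
rewrite lognM ?expn_gt0 ?D0 // !lognX /= => F.
have : n %| 1 by rewrite -(dvdn_addl _ (dvdn_mulr (logn 2 D) (dvdnn n))) -F dvdn_mulr.
by rewrite dvdn1; case: eqP n1 => // ->.
Qed.

(** [S] is the geometric sum left after factoring the difference of the squares of [x + y] and
    [x - y] out of the difference of their [h]-th powers; each of its [h] terms is at most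
    [(x + y) ^ (h.*2 - 2)]. *)
Lemma subn_exp_double h x y : 0 < h -> 0 < y -> y < x ->
  exists2 S, (x + y) ^ h.*2 - (x - y) ^ h.*2 = 4 * (x * y) * S
    & 0 < S <= h * (x + y) ^ (h.*2 - 2).
Proof.
move=> h0 y0 yx.
pose S := \sum_(i < h) ((x + y) ^ 2) ^ (h.-1 - i) * ((x - y) ^ 2) ^ i.
have subE : (x + y) ^ h.*2 - (x - y) ^ h.*2 = 4 * (x * y) * S.
  rewrite -mul2n !(expnM _ 2) subn_exp; congr (_ * _).
  rewrite -(subnK (ltnW yx)); move: (x - y) => z; rewrite addnK.
  by rewrite (_ : (z + y + y) ^ 2 = 4 * ((z + y) * y) + z ^ 2) ?addnK //; ring.
exists S => //; apply/andP; split.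
  have : 0 < (x + y) ^ h.*2 - (x - y) ^ h.*2.
    by rewrite subn_gt0 ltn_exp2r ?double_gt0 //; lia.
  by rewrite subE muln_gt0 => /andP[].
have -> : h.*2 - 2 = 2 * h.-1 by clear; lia.
rewrite -[X in X * _]card_ord -sum_nat_const; apply: leq_sum => i _.
rewrite expnM -[X in _ <= _ ^ X](@subnK i); last by rewrite -ltnS prednK.
rewrite expnD leq_mul2l; apply/orP; right.
by case: (val i) => // j; rewrite !leq_exp2r //; lia.
Qed.

Lemma congruent_triple N x y (n := (N * totient N).*2) :
  0 < N -> 0 < y -> y < x -> coprime x y ->
  exists C D, [/\ 0 < D < C, coprime C D, x + y <= 2 * C,
    N %| D ^ n * (C ^ n - D ^ n) * C ^ n &
    radn (D ^ n * (C ^ n - D ^ n) * C ^ n)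
      <= radn (x * y * (x + y)) * (n * (x + y) ^ n.-1)].
Proof.
move=> N0 y0 yx cxy; pose t := gcdn (x + y) (x - y).
have tc : t %| x + y by apply: dvdn_gcdl.
have td : t %| x - y by apply: dvdn_gcdr.
(* [t] divides both [2 * x] and [2 * y], whose gcd is 2. *)
have t2 : t %| 2.
  have tx : t %| x * 2.
    have -> : x * 2 = (x + y) + (x - y) by lia.
    exact: dvdn_add.
  have ty : t %| y * 2.
    have -> : y * 2 = (x + y) - (x - y) by lia.
    exact: dvdn_sub.
  have : t %| gcdn (x * 2) (y * 2) by rewrite dvdn_gcd tx ty.
  by rewrite -muln_gcdl (eqP cxy) mul1n.
have t0 : 0 < t by apply: dvdn_gt0 t2.
have le_t2 : t <= 2 by apply: dvdn_leq.
have [C cE] : exists C, x + y = C * t by apply/dvdnP.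
have [D dE] : exists D, x - y = D * t by apply/dvdnP.
have D0 : 0 < D by rewrite -(ltn_pmul2r t0) -dE subn_gt0.
have DC : D < C by rewrite -(ltn_pmul2r t0) -cE -dE; lia.
exists C, D; split.
- by rewrite D0.
- by move/eqP: (erefl t); rewrite {1}/t cE dE -muln_gcdl -{2}[t]mul1n eqn_pmul2r.
- by rewrite cE mulnC leq_mul2r le_t2 orbT.
- exact: dvdn_expM_sub_exp.
have n2 : 1 < n.
  have h0 : 0 < N * totient N by rewrite muln_gt0 N0 totient_gt0.
  by rewrite /n -mul2n; lia.
have [S subE SE] : exists2 S, (x + y) ^ n - (x - y) ^ n = 4 * (x * y) * S
    & 0 < S /\ 2 * S <= n * (x + y) ^ (n - 2).
  have h0 : 0 < N * totient N by rewrite muln_gt0 N0 totient_gt0.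
  have [S E /andP[S0 SE]] := subn_exp_double _ _ _ h0 y0 yx; exists S => //; split=> //.
  by rewrite /n -{1}mul2n -mulnA leq_mul2l.
case: SE => S0 SE; clear t2 le_t2 tc td t0 D0 DC.
clearbody n.
set r := radn (x * y * (x + y)).
have r0 : 0 < r by apply: radn_gt0.
have xyc0 : 0 < x * y * (x + y) by rewrite !muln_gt0; lia.
(* This product contains every prime in question: those of [C], [x] and [y] through [r], those of
   [D] through [x - y], and the remaining ones of [C ^ n - D ^ n] through 2 or [S]. *)
apply: (@leq_trans (r * (2 * (x - y) * S))); last first.
  rewrite leq_mul2l; apply/orP; right.
  have -> : n.-1 = (n - 2).+1 by lia.
  by rewrite expnS mulnAC mulnCA mulnC leq_mul //; clear; lia.
apply: dvdn_leq; first by rewrite !muln_gt0 r0 S0 /= subn_gt0 yx.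
apply: radn_dvd => p pp; rewrite !Euclid_dvdM // => /orP[/orP[]|].
- rewrite Euclid_dvdX // => /andP[pD _].
  by rewrite dE (dvdn_mulr t pD) !orbT.
(* Multiplying by [t ^ n] turns [C ^ n - D ^ n] into [4 * (x * y) * S]. *)
- move/(dvdn_mulr (t ^ n)); rewrite mulnBl -!expnMn -cE -dE subE.
  rewrite !Euclid_dvdM // (_ : 4 = 2 ^ 2) // Euclid_dvdX // andbT.
  case/orP=> [/orP[->|pxy]|->]; rewrite ?orbT //.
  by rewrite dvdn_radn //; apply: dvdn_mulr; rewrite Euclid_dvdM.
- rewrite Euclid_dvdX // => /andP[pC _].
  by rewrite dvdn_radn //; apply: dvdn_mull; rewrite cE dvdn_mulr.
Qed.

End Descent.

Local Open Scope ring_scope.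

Lemma ABC_f_swap (R : realType) (a b c : int) (eps : R) :
  ABC_f b a c eps = ABC_f a b c eps.
Proof. by rewrite /ABC_f (mulrC b a). Qed.

Lemma ABC_solution_exp n C D : (1 < n)%N -> (0 < D < C)%N -> coprime C D ->
  ABC_solution (- (D ^ n)%:Z) (- (C ^ n - D ^ n)%:Z) (C ^ n)%:Z.
Proof.
move=> n1 /andP[D0 DC] cCD.
have Dn0 : (0 < D ^ n)%N by rewrite expn_gt0 D0.
have DCn : (D ^ n < C ^ n)%N by rewrite ltn_exp2r //; lia.
have := @expn_neq_double_expn n C D n1 D0.
have : coprime (C ^ n) (D ^ n) by rewrite coprimeXl ?coprimeXr.
move: (C ^ n)%N (D ^ n)%N Dn0 DCn => c d d0 dc ccd ne.
split; [by split; lia| |lia|by split; lia].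
apply/eqP; rewrite /gcdz !abszN !absz_nat eqz_nat -dvdn1 -(eqP ccd).
by rewrite dvdn_gcd dvdn_gcdr (dvdn_trans (dvdn_gcdl _ _)) ?dvdn_gcdl.
Qed.

Lemma ABC_solution_nat a b c : ABC_solution a b c -> (a > b)%R ->
  exists x y : nat, [/\ a = - y%:Z, b = - x%:Z, c = (x + y)%:Z, (0 < y < x)%N
    & coprime x y].
Proof.
move=> [_ g s [a0 b0]] ab; exists `|b|%N, `|a|%N; split; try lia.
move/eqP: g; rewrite (_ : c = - (a + b)); last by lia.
rewrite /gcdz abszN eqz_nat !absz_nat /coprime => /eqP g.
rewrite -dvdn1 -g !dvdn_gcd dvdn_gcdr dvdn_gcdl /=.
(* A common divisor of [a] and [b] also divides their sum, so the triple gcd is already that of the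
   pair. *)
have -> : `|(a + b)%R|%N = (`|b| + `|a|)%N by lia.
by rewrite dvdn_add ?dvdn_gcdl ?dvdn_gcdr.
Qed.

Theorem theorem1 (R : realType) (N : nat) (hN : (0 < N)%N)
  (H : forall eps : R, 0 < eps ->
     exists C : R, forall a b c : int,
       ABC_solution a b c -> (N%:Z %| a * b * c)%Z -> ABC_f a b c eps < C) :
  forall eps : R, 0 < eps ->
    exists C' : R, forall a b c : int,
      ABC_solution a b c -> ABC_f a b c eps < C'.
Proof.
move=> eps eps0; pose n := (N * totient N).*2.
have n1 : (1 < n)%N by have : (0 < totient N)%N; [rewrite totient_gt0 | rewrite /n; nia].
pose m : R := n.-1%:R.
have m0 : 0 <= m by rewrite ler0n.
have nE : n%:R = m + 1 :> R by rewrite natr1 prednK // ltnW.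
have den0 : 0 < 1 + (1 + eps) * m.
  by rewrite ltr_pwDl // mulr_ge0 // addr_ge0 // ltW.
(* The solution of [1 + delta = (1 - m * delta) * (1 + eps)]. *)
pose delta := eps / (1 + (1 + eps) * m).
have delta0 : 0 < delta by rewrite divr_gt0.
have [K HK] := H delta delta0.
pose k := 1 - m * delta.
have kE : 1 + delta = k * (1 + eps).
  by rewrite /k /delta; field; rewrite gt_eqF.
have k0 : 0 < k by rewrite -(@pmulr_lgt0 _ (1 + eps)) -?kE addr_gt0.
(* The [ln 2] term pays for [x + y <= 2 * C] raised to the power [n = m + 1], and the [ln n] term
   for the factor [n] in the radical bound. *)
pose K' := (K + (m + 1) * ln 2 + (1 + delta) * ln n%:R) / k.
suff main a b c : ABC_solution a b c -> a > b -> ABC_f a b c eps < K'.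
  exists K' => a b c sol; have [ab|ba|abE] := ltgtP b a.
  - exact: main.
  - rewrite -ABC_f_swap; apply: main => //.
    case: sol => -[h1 h2 h3] g s [a0 b0]; split; [split; lia| |lia|by split].
    by rewrite -g (gcdzC a b).
  - by case: sol => -[h1 _ _] _ _ _; rewrite abE in h1.
move=> sol ab; have [x [y [-> -> -> /andP[y0 yx] cxy]]] := ABC_solution_nat _ _ _ sol ab.
have [C [D [DC cCD le2C dvdN ler]]] := @congruent_triple N x y hN y0 yx cxy.
have sol' := @ABC_solution_exp n C D n1 DC cCD.
have prodE : `|(- (D ^ n)%:Z * - (C ^ n - D ^ n)%:Z * (C ^ n)%:Z)%R|%N =
    (D ^ n * (C ^ n - D ^ n) * C ^ n)%N.
  by rewrite mulrNN -!PoszM absz_nat.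
have := HK _ _ _ sol'; rewrite dvdzE prodE => /(_ dvdN).
rewrite /ABC_f prodE mulrNN -!PoszM !absz_nat -!pmulrn (mulnC y x).
move: ler; set r := radn _; set r0 := radn _ => ler.
have r_gt0 : (0 < r)%N by apply: radn_gt0.
have r0_gt0 : (0 < r0)%N by apply: radn_gt0.
have C0 : (0 < C)%N by case/andP: DC => _; apply: leq_ltn_trans.
have c0 : (0 < x + y)%N by rewrite addn_gt0 y0 orbT.
set L := ln (x + y)%:R.
have lnC : L - ln 2 <= ln C%:R :> R.
  rewrite lerBlDr -lnM ?posrE ?ltr0n // ler_ln ?posrE ?mulr_gt0 ?ltr0n //.
  by rewrite mulrC -natrM ler_nat.
have lnr : ln r%:R <= ln r0%:R + (ln n%:R + m * L) :> R.
  rewrite /m mulr_natl -lnXn ?ltr0n // -natrX.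
  rewrite -!lnM ?posrE ?mulr_gt0 ?ltr0n ?expn_gt0 ?c0 ?(ltnW n1) //.
  rewrite -!natrM ler_ln ?posrE ?ltr0n ?ler_nat //.
  by rewrite !muln_gt0 r0_gt0 expn_gt0 c0 (ltnW n1).
rewrite natrX lnXn ?ltr0n // -(mulr_natl (ln _) n) nE => bound.
(* After clearing [k] everything is linear in the logarithms: inserting [h1] and [h2] into [bound]
   leaves [L] with coefficient [(m + 1) - (1 + delta) * m], which is [k]. *)
rewrite ltr_pdivlMr // mulrBl [X in _ - X]mulrAC (mulrC (1 + eps)) -kE.
have h1 : (m + 1) * (L - ln 2) <= (m + 1) * ln C%:R by rewrite ler_wpM2l // addr_ge0.
have h2 : (1 + delta) * ln r%:R <= (1 + delta) * (ln r0%:R + (ln n%:R + m * L)).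
  by rewrite ler_wpM2l // addr_ge0 // ltW.
rewrite /k; lra.
Qed.
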